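(* Let $m,n\ge 3$ and $l\ge -1$ be integers. Then $$X_{\overline{D}(m,l,n)}=(m-1)X_{\overline{D}(m-1,l+1,n)}-(m-2)X_{K_{m-1}}X_{L_{n,l+1}}.$$
   Context: All graphs are finite and simple; $P_l$ and $K_n$ denote the path and the complete graph on the indicated number of vertices. For $m,n\ge 3$ and $l\ge 2$, the complete dumbbell graph $\overline{D}(m,l,n)$ consists of disjoint $K_m$, $K_n$ and $P_l$, with one leaf of $P_l$ connected by an edge to one vertex of $K_m$ and the other leaf connected by an edge to one vertex of $K_n$. For $l=1$, the single vertex of $P_1$ is adjacent to one vertex of $K_m$ and to one vertex of $K_n$. For $l=0$, it is $K_m$ and $K_n$ (disjoint) connected by an edge. For $l=-1$, it is $K_m$ and $K_n$ sharing exactly one vertex. For $a\ge 3$, $b\ge 1$, the lollipop graph $L_{a,b}$ is obtained by connecting by an edge one vertex of $K_a$ and one leaf of $P_b$ (the single vertex if $b=1$); $L_{a,0}$ means $K_a$. By convention, $\overline{D}(m,l,n)$ for $m\in\{0,1,2\}$ means the lollipop $L_{n,l+m}$. The chromatic symmetric function of a graph $G$ with vertices $v_1,\ldots,v_d$ is $X_G=\sum_{\kappa} x_{\kappa(v_1)}\cdots x_{\kappa(v_d)}$, the sum over all proper colourings $\kappa:V(G)\to\mathbb{N}$, with $x_1,x_2,\ldots$ commuting variables. *)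

(* Defs.v *)
From HB Require Import structures.
From mathcomp Require Import all_boot all_order all_algebra finmap.
From mathcomp Require Import mathcomp_extra boolp classical_sets functions.
From mathcomp Require Import cardinality fsbigop.
From mathcomp.multinomials Require Import monalg.

Set Implicit Arguments.
Unset Strict Implicit.
Unset Printing Implicit Defensive.

Import Order.TTheory GRing.Theory Num.Theory.
Local Open Scope ring_scope.
Local Open Scope classical_set_scope.

Record sgraph := SGraph {
  vertex : finType;
  edge : rel vertex;
  edge_sym : symmetric edge;
  edge_irrefl : irreflexive edge }.

Fact complete_sym n : symmetric (fun i j : 'I_n => i != j).
Proof. by move=> i j; rewrite eq_sym. Qed.

Fact complete_irrefl n : irreflexive (fun i j : 'I_n => i != j).
Proof. by move=> i; rewrite eqxx. Qed.

Definition complete_graph (n : nat) : sgraph :=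
  SGraph (@complete_sym n) (@complete_irrefl n).

(* L_{a,b}: the vertices 0, ..., a-1 span K_a, the vertices a, ..., a+b-1 are
   those of P_b in order, and the connecting edge joins a-1 and a. *)
Definition lollipop_edge (a b : nat) : rel 'I_(a + b) := fun i j =>
  (i != j) && [|| (i < a)%N && (j < a)%N, i.+1 == j :> nat | j.+1 == i :> nat].

Fact lollipop_sym a b : symmetric (@lollipop_edge a b).
Proof.
move=> i j; rewrite /lollipop_edge eq_sym; congr (_ && _).
by rewrite andbC; congr (_ || _); rewrite orbC.
Qed.

Fact lollipop_irrefl a b : irreflexive (@lollipop_edge a b).
Proof. by move=> i; rewrite /lollipop_edge eqxx. Qed.

Definition lollipop (a b : nat) : sgraph :=
  SGraph (@lollipop_sym a b) (@lollipop_irrefl a b).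

(* For l >= -1 the m + l + n vertices are laid out on a line: 0, ..., m-1 span
   K_m, the last n vertices m+l, ..., m+l+n-1 span K_n, and m, ..., m+l-1 are
   the vertices of P_l.  All consecutive vertices are adjacent, so for l >= 1
   the path is attached to the vertices m-1 of K_m and m+l of K_n; for l = 0
   these two vertices are m-1 and m and are joined by an edge; for l = -1 they
   coincide and K_m and K_n share exactly the vertex m-1. *)
Definition dumbbell_edge (m : nat) (l : int) (n : nat) :
    rel 'I_(absz (m%:Z + l + n%:Z)) := fun i j =>
  (i != j) && [|| (i < m)%N && (j < m)%N,
                  (m%:Z + l <= i%:Z) && (m%:Z + l <= j%:Z),
                  i.+1 == j :> nat | j.+1 == i :> nat].

Fact dumbbell_sym m l n : symmetric (@dumbbell_edge m l n).
Proof.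
move=> i j; rewrite /dumbbell_edge eq_sym; congr (_ && _).
rewrite andbC; congr (_ || _); rewrite andbC; congr (_ || _).
by rewrite orbC.
Qed.

Fact dumbbell_irrefl m l n : irreflexive (@dumbbell_edge m l n).
Proof. by move=> i; rewrite /dumbbell_edge eqxx. Qed.

(* Meaningful for n >= 3, and for l >= -1 if m >= 3, l + m >= 0 if m <= 2. *)
Definition dumbbell (m : nat) (l : int) (n : nat) : sgraph :=
  if (m <= 2)%N then lollipop n (absz (l + m%:Z))
  else SGraph (@dumbbell_sym m l n) (@dumbbell_irrefl m l n).

(* Formal power series over int in variables x_0, x_1, ..., given by their
   coefficients.  Addition and integer multiples are the pointwise ones, but
   the pointwise product that {cmonom nat} -> int also carries is not the
   product of series, which is fps_mul. *)
Definition fps : Type := {cmonom nat} -> int.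
HB.instance Definition _ := GRing.Zmodule.copy fps ({cmonom nat} -> int).

Definition monom_decomp (w : {cmonom nat}) :
  set ({cmonom nat} * {cmonom nat}) := [set p | mmul p.1 p.2 = w].

(* The fsbig sums here and in chromatic_sym would be 0 on an infinite support;
   finite_monom_decomp and finite_colorings_with_monom exclude this. *)
Definition fps_mul (f g : fps) : fps :=
  fun w => \sum_(p \in monom_decomp w) f p.1 * g p.2.

Definition proper_coloring (G : sgraph) (k : {ffun vertex G -> nat}) : Prop :=
  forall u v : vertex G, edge u v -> k u <> k v.

Definition coloring_monom (G : sgraph) (k : {ffun vertex G -> nat}) :
  {cmonom nat} := \big[mmul/mone]_(v : vertex G) ucm (k v).

Definition colorings_with_monom (G : sgraph) (w : {cmonom nat}) :
    set {ffun vertex G -> nat} :=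
  [set k | proper_coloring k /\ coloring_monom k = w].

Arguments colorings_with_monom : clear implicits.

(* The coefficient of w in \sum_k x_{k(v_1)} ... x_{k(v_d)}. *)
Definition chromatic_sym (G : sgraph) : fps :=
  fun w => \sum_(k \in colorings_with_monom G w) (1 : int).

Lemma finite_monom_decomp (w : {cmonom nat}) : finite_set (monom_decomp w).
Proof.
pose B := (\max_(i : finsupp w) w (val i)).+1.
pose h (e : {ffun finsupp w -> 'I_B}) : {cmonom nat} :=
  mkcmonom [fsfun i : finsupp w => e i : nat | 0%N].
apply: (@sub_finite_set _ _
  ([set h e | e in [set: {ffun finsupp w -> 'I_B}]]
   `*` [set h e | e in [set: {ffun finsupp w -> 'I_B}]])); last first.
  by apply: finite_setX; apply: finite_image; exact: finite_finset.
have dvd_h (a : {cmonom nat}) : (forall i, a i <= w i)%N ->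
    [set h e | e in [set: {ffun finsupp w -> 'I_B}]] a.
  move=> aw; exists [ffun i => inord (a (val i))] => //.
  apply/eqP/cmP => i; rewrite cmE fsfun_ffun; case: insubP => [u iw ui|iw] /=.
    rewrite ffunE inordK -?ui // ltnS (leq_trans (aw _)) //.
    exact: (leq_bigmax (F := fun i : finsupp w => w (val i))).
  by move: (aw i); rewrite (fsfun_dflt iw) leqn0 => /eqP.
move=> [a b] /= abw; split => /=; apply: dvd_h => i.
  by rewrite -abw cmM leq_addr.
by rewrite -abw cmM leq_addl.
Qed.

Lemma finite_colorings_with_monom (G : sgraph) (w : {cmonom nat}) :
  finite_set (colorings_with_monom G w).
Proof.
pose h (e : {ffun vertex G -> finsupp w}) : {ffun vertex G -> nat} :=
  [ffun v => val (e v)].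
apply: (@sub_finite_set _ _
  [set h e | e in [set: {ffun vertex G -> finsupp w}]]); last first.
  by apply: finite_image; exact: finite_finset.
move=> k [_ kw].
have kP v : k v \in finsupp w.
  by rewrite -cmE_neq0 -kw /coloring_monom (bigD1 v) //= cmM cmUU.
exists [ffun v => [` kP v]%fset] => //.
by apply/ffunP => v; rewrite !ffunE.
Qed.

(* Main.v *)
Require Import Defs.
From mathcomp Require Import all_boot all_order all_algebra.
From mathcomp Require Import boolp classical_sets functions cardinality fsbigop.
From mathcomp Require Import perm finmap zify.
From mathcomp.multinomials Require Import monalg.

Set Implicit Arguments.
Unset Strict Implicit.
Unset Printing Implicit Defensive.

Import GRing.Theory.

Local Open Scope ring_scope.

(** Removing from [K_m] the vertex [r] that carries the path of the dumbbell
leaves a complete graph on [p = m - 1] vertices.  The removed vertex,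
together with the path and the other clique, forms a lollipop [L].  On the
disjoint vertices of [K_p] and [L], the three graphs of the identity differ
only in which vertices of [K_p] are adjacent to [r]: all of them
([join_at]), exactly one ([bridge]), or none ([disjoint_graph]).

A proper colouring of the disjoint union uses the colour of [r] at most once
in [K_p], because the colours inside a clique are distinct.  Hence the number
of vertices of [K_p] whose colour differs from that of [r] is [p] if the
colouring is proper for [join_at], and [p - 1] otherwise.  Counting the pairs
of such a vertex and a colouring, monomial by monomial, gives
[sum_link_clique]: the sum of the series of the [p] bridged graphs is the
series of the joined graph plus [p - 1] times the series of the disjoint
union.  The [p] bridged graphs are isomorphic ([chromatic_sym_bridge_clique]),
and the series of the disjoint union is a product
([chromatic_sym_disjoint]), so solving for the joined graph gives the
identity.  It remains to recognise the graphs laid out on a line as the joined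
and the bridged graph ([dumbbell_joinE], [dumbbell_bridgeE]); the bridged
graph on [K_2] is where dumbbells degenerate to lollipops. *)

(** * Invariance under isomorphism *)

Lemma chromatic_sym_iso (G H : sgraph) (f : vertex G -> vertex H) :
    bijective f -> (forall u v, edge (f u) (f v) = edge u v) ->
  chromatic_sym G = chromatic_sym H.
Proof.
move=> [g fK gK] fE; apply/funext => w; rewrite /chromatic_sym.
pose h (k : {ffun vertex H -> nat}) : {ffun vertex G -> nat} :=
  [ffun u => k (f u)].
apply: (reindex_fsbig h); split.
- move=> k [kP kw]; split.
    by move=> u v uv; rewrite !ffunE; apply: kP; rewrite fE.
  rewrite -kw /coloring_monom (reindex f) /=; last by exists g => ? _.
  by apply: eq_bigr => u _; rewrite ffunE.
- move=> k1 k2 _ _ /ffunP k12; apply/ffunP => v.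
  by have := k12 (g v); rewrite !ffunE gK.
- move=> k [kP kw]; exists [ffun v => k (g v)]; last first.
    by apply/ffunP => u; rewrite !ffunE fK.
  split.
    by move=> u v uv; rewrite !ffunE; apply: kP; rewrite -fE !gK.
  rewrite -kw /coloring_monom (reindex f) /=; last by exists g => ? _.
  by apply: eq_bigr => u _; rewrite ffunE fK.
Qed.

(** * Linking two graphs *)

(** All the graphs compared below have the same vertices and differ only in
the edges [S] between the two parts, so that their colourings live in a single
type. *)
Definition link_edge (G1 G2 : sgraph) (S : vertex G1 -> vertex G2 -> bool) :
    rel (vertex G1 + vertex G2)%type := fun x y =>
  match x, y with
  | inl u, inl v => edge u v
  | inr u, inr v => edge u v
  | inl u, inr v => S u v
  | inr v, inl u => S u v
  end.

Fact link_sym G1 G2 S : symmetric (@link_edge G1 G2 S).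
Proof. by case=> u [] v //=; exact: edge_sym. Qed.

Fact link_irrefl G1 G2 S : irreflexive (@link_edge G1 G2 S).
Proof. by case=> u /=; exact: edge_irrefl. Qed.

Definition link G1 G2 S : sgraph :=
  SGraph (@link_sym G1 G2 S) (@link_irrefl G1 G2 S).

Definition disjoint_graph (G1 G2 : sgraph) : sgraph :=
  @link G1 G2 (fun _ _ => false).

Definition bridge (G1 G2 : sgraph) (a : vertex G1) (r : vertex G2) : sgraph :=
  @link G1 G2 (fun u v => (u == a) && (v == r)).

Definition join_at (G1 G2 : sgraph) (r : vertex G2) : sgraph :=
  @link G1 G2 (fun _ v => v == r).

(** Extra edges only discard colourings, so the colourings of the disjoint
union serve as a common index set on which series of linked graphs can be
compared term by term. *)
Lemma chromatic_sym_linkE (G1 G2 : sgraph) S (w : {cmonom nat}) :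
  chromatic_sym (@link G1 G2 S) w =
  \sum_(k \in colorings_with_monom (disjoint_graph G1 G2) w)
    ([forall u, forall v, S u v ==> (k (inl u) != k (inr v))]%:R : int).
Proof.
pose ok : set {ffun (vertex G1 + vertex G2)%type -> nat} :=
  [set k | [forall u, forall v, S u v ==> (k (inl u) != k (inr v))]]%classic.
rewrite /chromatic_sym.
transitivity (\sum_(k \in
  (colorings_with_monom (disjoint_graph G1 G2) w `&` ok)%classic) (1 : int)).
  apply: eq_fsbigl; apply/seteqP; split=> k /=.
    move=> [kP kw]; split; first split=> //.
      by move=> [] u [] v //= uv; apply: kP.
    apply/forallP => u; apply/forallP => v; apply/implyP => uv.
    by apply/eqP; apply: kP.
  move=> [[kP kw] /forallP kS]; split=> //.
  have kS' u v : S u v -> k (inl u) <> k (inr v).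
    by move=> uv; apply/eqP; have /forallP/(_ v)/implyP := kS u; apply.
  move=> [] u [] v //= uv; first exact: kP.
  - exact: kS'.
  - by apply/nesym/kS'.
  - exact: kP.
rewrite fsbig_mkcondr; apply: eq_fsbigr => k _.
case: ifPn => [/set_mem/= -> //|kS].
rewrite (_ : [forall u, _] = false) //.
by apply: contraNF kS => kS; exact: mem_set.
Qed.

(** A proper colouring of the disjoint union is a pair of proper colourings,
and sorting these pairs by their two monomials yields the terms of the product
of series. *)
Lemma chromatic_sym_disjoint (G1 G2 : sgraph) :
  chromatic_sym (disjoint_graph G1 G2) =
  fps_mul (chromatic_sym G1) (chromatic_sym G2).
Proof.
apply/funext => w; rewrite /fps_mul.
pose C := colorings_with_monom (disjoint_graph G1 G2) w.
pose k1 (k : {ffun (vertex G1 + vertex G2)%type -> nat}) :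
  {ffun vertex G1 -> nat} := [ffun u => k (inl u)].
pose k2 (k : {ffun (vertex G1 + vertex G2)%type -> nat}) :
  {ffun vertex G2 -> nat} := [ffun u => k (inr u)].
pose mm k := (coloring_monom (G := G1) (k1 k), coloring_monom (G := G2) (k2 k)).
have mmC k : mmul (mm k).1 (mm k).2 =
    coloring_monom (G := disjoint_graph G1 G2) k.
  rewrite /mm /coloring_monom /= big_sumType /=.
  by congr mmul; apply: eq_bigr => u _; rewrite ffunE.
have finC : finite_set C by exact: finite_colorings_with_monom.
have finD := finite_monom_decomp w.
transitivity (\sum_(p \in monom_decomp w) \sum_(k \in C) ((mm k == p)%:R : int)).
  rewrite exchange_fsbig //; apply: eq_fsbigr => k /set_mem [kP kw].
  rewrite (fsbigD1 (mm k)) //=; last by rewrite /monom_decomp/= mmC.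
  rewrite eqxx fsbig1 ?addr0// => p [_ /=].
  by case: eqVneq => // -> /(_ erefl).
apply: eq_fsbigr => p /set_mem pw.
rewrite /chromatic_sym mulr_fsuml.
under [RHS]eq_fsbigr do rewrite mul1r.
rewrite pair_fsbig; [|exact: finite_colorings_with_monom..].
transitivity (\sum_(k \in (C `&` [set k | mm k = p])%classic) (1 : int)).
  rewrite [RHS]fsbig_mkcondr; apply: eq_fsbigr => k _.
  case: eqVneq => [kp|/eqP kp]; first by rewrite mem_set.
  by rewrite memNset.
symmetry; apply: (reindex_fsbig (fun k => (k1 k, k2 k))); split.
- move=> k [[kP _]] /= kp; rewrite -kp; split; split=> //= u v uv.
    by rewrite !ffunE; apply: kP.
  by rewrite !ffunE; apply: kP.
- move=> k k' _ _ [] /ffunP e1 /ffunP e2; apply/ffunP => -[] u.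
    by have := e1 u; rewrite !ffunE.
  by have := e2 u; rewrite !ffunE.
- move=> [c1 c2] [/= [c1P c1w] [c2P c2w]].
  pose k : {ffun (vertex G1 + vertex G2)%type -> nat} :=
    [ffun x => match x with inl u => c1 u | inr v => c2 v end].
  have e1 : k1 k = c1 by apply/ffunP => u; rewrite !ffunE.
  have e2 : k2 k = c2 by apply/ffunP => u; rewrite !ffunE.
  have kp : mm k = p by rewrite /mm e1 e2 c1w c2w; case: (p).
  exists k; last by rewrite e1 e2.
  split=> //; split; last by rewrite -mmC kp.
  by move=> [] u [] v //= uv; rewrite !ffunE; [apply: c1P|apply: c2P].
Qed.

(** * The clique identity *)

(** For a fixed colouring of the disjoint union, the left-hand side counts the
vertices of the clique whose colour differs from that of [r]; at most one
vertex fails to, since the colours in the clique are distinct. *)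
Lemma sum_link_clique (p : nat) (G : sgraph) (r : vertex G) : (0 < p)%N ->
  \sum_(a < p) chromatic_sym (@bridge (complete_graph p) G a r) =
  chromatic_sym (join_at (complete_graph p) r) +
  chromatic_sym (disjoint_graph (complete_graph p) G) *+ p.-1.
Proof.
move=> p_gt0; apply/funext => w.
have -> : forall F : 'I_p -> fps, (\sum_(a < p) F a) w = \sum_(a < p) F a w.
  by move=> F; elim/big_rec2: _ => // a _ y _ <-.
have -> : forall (f g : fps), (f + g) w = f w + g w by [].
have -> : forall (f : fps) m, (f *+ m) w = f w *+ m.
  by move=> f; elim=> // m IH; rewrite !mulrS -IH.
under eq_bigr do rewrite chromatic_sym_linkE.
rewrite chromatic_sym_linkE /chromatic_sym.
have finC := finite_colorings_with_monom (disjoint_graph (complete_graph p) G) w.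
rewrite !fsbig_finite //.
under eq_bigr do rewrite fsbig_finite //.
rewrite exchange_big /= -sumrMnl -big_split /=.
rewrite !big_seq; apply: eq_bigr => k.
rewrite in_fset_set // => /set_mem [kP _].
have oneE (a : 'I_p) : [forall u, forall v, ((u == a) && (v == r)) ==>
    (k (inl u) != k (inr v))] = (k (inl a) != k (inr r)).
  apply/forallP/idP => [/(_ a)/forallP/(_ r)|ka u]; first by rewrite !eqxx.
  by apply/forallP => v; apply/implyP => /andP[/eqP-> /eqP->].
have allE : [forall u : 'I_p, forall v, (v == r) ==>
    (k (inl u) != k (inr v))] = [forall u : 'I_p, k (inl u) != k (inr r)].
  apply: eq_forallb => u; apply/forallP/idP => [/(_ r)|ku v].
    by rewrite eqxx.
  by apply/implyP => /eqP->.
under eq_bigr do rewrite oneE.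
rewrite allE; case: (boolP [forall u, _]) => [/forallP kr|].
  under eq_bigr do rewrite kr.
  by rewrite sumr_const card_ord -mulrS prednK.
(* Some vertex a has the colour of r; then every other vertex of the clique
   contributes 1, because its colour differs from that of a. *)
rewrite negb_forall => /existsP[a]; rewrite negbK => /eqP ka.
rewrite (bigD1 a) //= -ka eqxx !add0r.
under eq_bigr => b ba.
  have -> : k (inl b) != k (inl a) by apply/eqP/kP; exact: ba.
  over.
by rewrite sumr_const cardC1 card_ord.
Qed.

Lemma chromatic_sym_bridge_clique (p : nat) (G : sgraph) (r : vertex G)
    (a a' : 'I_p) :
  chromatic_sym (@bridge (complete_graph p) G a r) =
  chromatic_sym (@bridge (complete_graph p) G a' r).
Proof.
pose t (x : 'I_p + vertex G) : 'I_p + vertex G :=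
  match x with inl u => inl (tperm a a' u) | inr v => inr v end.
have tK : involutive t by case=> u //=; rewrite tpermK.
apply: (@chromatic_sym_iso (@bridge (complete_graph p) G a r)
          (@bridge (complete_graph p) G a' r) t); first exact: inv_bij.
have tE u : (tperm a a' u == a') = (u == a).
  by rewrite -[X in _ == X](tpermL a a') (inj_eq perm_inj).
by case=> u [] v //=; rewrite ?tE ?(inj_eq perm_inj).
Qed.

(** * Dumbbells as linked graphs *)

(** The vertex sets of dumbbells and lollipops are initial segments whose
lengths are differently shaped expressions, even when they are equal.  An
injective placement of the right cardinality identifies the graphs without
casts or an inverse map. *)
Lemma chromatic_sym_layout (G : sgraph) (N : nat) (e : rel 'I_N)
    (e_sym : symmetric e) (e_irr : irreflexive e) (pos : vertex G -> nat)
    (posP : forall x, (pos x < N)%N) :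
    injective pos -> #|vertex G| = N ->
    (forall x y, e (Ordinal (posP x)) (Ordinal (posP y)) = edge x y) ->
  chromatic_sym (SGraph e_sym e_irr) = chromatic_sym G.
Proof.
move=> pos_inj cardG posE; symmetry.
apply: (chromatic_sym_iso (H := SGraph e_sym e_irr)
          (f := fun x => Ordinal (posP x))) => //.
apply: inj_card_bij => [x y [/pos_inj]//|].
by rewrite /= card_ord cardG.
Qed.

(** The second part is reversed because a lollipop numbers its clique first,
whereas here the end of its path has to face [K_p]. *)
Definition line_pos (p q : nat) (x : 'I_p + 'I_q) : nat :=
  match x with inl i => i | inr j => (p + q).-1 - j end.

Lemma line_pos_lt p q (x : 'I_p + 'I_q) : (line_pos x < p + q)%N.
Proof. by case: x => [[i hi]|[j hj]]; rewrite /line_pos /=; lia. Qed.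

Lemma line_pos_inj p q : injective (@line_pos p q).
Proof.
move=> [[i hi]|[j hj]] [[i' hi']|[j' hj']]; rewrite /line_pos /= => e.
- by congr inl; apply: val_inj.
- by lia.
- by lia.
- by congr inr; apply: val_inj => /=; lia.
Qed.

(** The vertex of the left clique that carries the path is counted here with
the lollipop, whose path therefore has one vertex more than that of the
dumbbell; for [b = 0] it is the vertex shared by the two cliques. *)
Lemma dumbbell_joinE (p b n : nat) (r : vertex (lollipop n b)) :
    (1 < p)%N -> r.+1 = (n + b)%N :> nat ->
  chromatic_sym (dumbbell p.+1 (b%:Z - 1) n) =
  chromatic_sym (join_at (complete_graph p) r).
Proof.
move=> hp rE; rewrite /dumbbell ifN -?ltnNge //.
have posP (x : 'I_p + 'I_(n + b)) :
    (line_pos x < absz (p.+1%:Z + (b%:Z - 1) + n%:Z)%R)%N.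
  by have := line_pos_lt x; lia.
apply: (@chromatic_sym_layout (join_at (complete_graph p) r) _ _ _ _ _ posP).
- exact: line_pos_inj.
- by rewrite card_sum !card_ord; lia.
- by move=> [[i hi]|[j hj]] [[i' hi']|[j' hj']];
    rewrite /line_pos /= /dumbbell_edge /lollipop_edge -?val_eqE /=; lia.
Qed.

Lemma dumbbell_bridgeE (p b n : nat) (a : vertex (complete_graph p))
    (r : vertex (lollipop n b)) :
    a.+1 = p :> nat -> r.+1 = (n + b)%N :> nat ->
  chromatic_sym (dumbbell p b%:Z n) = chromatic_sym (bridge a r).
Proof.
move=> aE rE.
rewrite /dumbbell; case: ifPn => [p2|p2].
  (* With at most two vertices, K_p merely prolongs the path; a lollipop
     starts with its clique, so the whole line is reversed. *)
  pose rev_pos (x : 'I_p + 'I_(n + b)) : nat :=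
    ((p + (n + b)).-1 - line_pos x)%N.
  have posP x : (rev_pos x < n + absz (b%:Z + p%:Z)%R)%N.
    by rewrite /rev_pos; lia.
  apply: (@chromatic_sym_layout (bridge a r) _ _ _ _ _ posP).
  - move=> x y; rewrite /rev_pos => e; apply: line_pos_inj.
    by have := line_pos_lt x; have := line_pos_lt y; lia.
  - by rewrite card_sum !card_ord; lia.
  - by move=> [[i hi]|[j hj]] [[i' hi']|[j' hj']];
      rewrite /rev_pos /line_pos /= /lollipop_edge -?val_eqE /=; lia.
have posP (x : 'I_p + 'I_(n + b)) :
    (line_pos x < absz (p%:Z + b%:Z + n%:Z)%R)%N.
  by have := line_pos_lt x; lia.
apply: (@chromatic_sym_layout (bridge a r) _ _ _ _ _ posP).
- exact: line_pos_inj.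
- by rewrite card_sum !card_ord; lia.
- by move=> [[i hi]|[j hj]] [[i' hi']|[j' hj']];
    rewrite /line_pos /= /dumbbell_edge /lollipop_edge -?val_eqE /=; lia.
Qed.

Theorem lemma4p9 (m n : nat) (l : int)
    (hm : (3 <= m)%N) (hn : (3 <= n)%N) (hl : -1 <= l) :
  chromatic_sym (dumbbell m l n) =
    chromatic_sym (dumbbell (m - 1) (l + 1) n) *+ (m - 1)
    - fps_mul (chromatic_sym (complete_graph (m - 1)))
              (chromatic_sym (lollipop n (absz (l + 1)))) *+ (m - 2).
Proof.
have [b lE] : {b : nat | l = b%:Z - 1} by exists (absz (l + 1)); lia.
case: m hm => // p hp; rewrite {}lE in hl *.
rewrite subrK !subSS subn0 subn1.
have nb_gt0 : ((n + b).-1 < n + b)%N by lia.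
have p_gt0 : (p.-1 < p)%N by lia.
pose r : vertex (lollipop n b) := Ordinal nb_gt0.
pose a : vertex (complete_graph p) := Ordinal p_gt0.
rewrite -chromatic_sym_disjoint (dumbbell_joinE (r := r)) /=; [|lia..].
rewrite (dumbbell_bridgeE (a := a) (r := r)) /=; [|lia..].
have := @sum_link_clique p (lollipop n b) r (leq_ltn_trans (leq0n _) p_gt0).
under eq_bigr => c _ do rewrite (chromatic_sym_bridge_clique r c a).
by rewrite sumr_const card_ord => ->; rewrite addrK.
Qed.
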